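(* Let $G$ be a connected finite simple graph with vertex set $\{1,\dots,p\}$ and $q$ edges. Then the $1$-skeleton of the graphicahedron $\mathcal{P}_G$ (the graph whose vertices are the rank-$0$ faces of $\mathcal{P}_G$, two being adjacent iff they are both below a common rank-$1$ face) is isomorphic to the Cayley graph $\mathcal{G}(G)$.
   Context: For an edge $e=\{i,j\}$ of $G$ let $\tau_e=(i\;j)\in S_p$. For $K\subseteq E(G)$ let $T_K=\langle \tau_e : e\in K\rangle\le S_p$ (trivial if $K=\emptyset$). The Cayley graph $\mathcal{G}(G)$ has vertex set $S_p$, with $\gamma_1,\gamma_2$ adjacent iff $\gamma_2=\tau_e\gamma_1$ for some edge $e$ of $G$. The graphicahedron $\mathcal{P}_G$ is the poset whose elements are the pairs $(K,\alpha)$, $K\subseteq E(G)$, $\alpha\in S_p$, modulo $(K,\alpha)\sim(L,\beta)$ iff $K=L$ and $T_K\alpha=T_L\beta$, ordered by $(K,\alpha)\le(L,\beta)$ iff $K\subseteq L$ and $T_K\alpha\subseteq T_L\beta$, with rank of $(K,\alpha)$ equal to $|K|$, together with an adjoined least element of rank $-1$. *)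

(* Defs.v *)
From HB Require Import structures.
From mathcomp Require Import all_order all_algebra all_fingroup.
From mathcomp Require Import all_boot generic_quotient.

Set Implicit Arguments.
Unset Strict Implicit.
Unset Printing Implicit Defensive.

Import GroupScope.

(* The vertex set {1, ..., p} is rendered as 'I_p; edges are 2-element sets. *)
Record sgraph (p : nat) := SGraph {
  edges : {set {set 'I_p}};
  edges_card2 : forall e, e \in edges -> #|e| = 2
}.

Definition adjacent p (G : sgraph p) : rel 'I_p :=
  [rel i j | [set i; j] \in edges G].

(* The graph with no vertices is not considered connected. *)
Definition connected p (G : sgraph p) : Prop :=
  0 < p /\ forall i j : 'I_p, connect (adjacent G) i j.

Definition edge p (G : sgraph p) := {e : {set 'I_p} | e \in edges G}.

(* [tau e] is the transposition (i j) when e = {i, j}, see [tauE]; it is a junk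
   value on the sets that are not of this form. *)
Definition tau p (e : {set 'I_p}) : 'S_p :=
  if [pick ij : 'I_p * 'I_p | e == [set ij.1; ij.2]] is Some ij
  then tperm ij.1 ij.2 else 1.

Lemma tauE p (i j : 'I_p) : tau [set i; j] = tperm i j.
Proof.
rewrite /tau; case: pickP => [[k l] /= /eqP E | /(_ (i, j))]; last by rewrite eqxx.
have := set21 i j; have := set22 i j; have := set21 k l; have := set22 k l.
rewrite E -{1 2}E !inE.
by do 4!(case/orP=> /eqP ?); subst; rewrite // tpermC.
Qed.

(* Products in 'S_p follow the library convention, (s * t) x = t (s x). With the
   opposite convention all the notions below are carried to isomorphic ones by
   the inversion of 'S_p, which fixes every transposition. *)
Definition T p (G : sgraph p) (K : {set edge G}) : {group 'S_p} :=
  <<[set tau (val e) | e in K]>>%G.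

Definition cayley_adj p (G : sgraph p) (g1 g2 : 'S_p) : Prop :=
  exists e : edge G, g2 = tau (val e) * g1.

Section Graphicahedron.
Variables (p : nat) (G : sgraph p).

Definition preface := ({set edge G} * 'S_p)%type.

Definition sim : rel preface := fun x y =>
  (x.1 == y.1) && (T x.1 :* x.2 == T y.1 :* y.2).

Definition pre_le : rel preface := fun x y =>
  (x.1 \subset y.1) && (T x.1 :* x.2 \subset T y.1 :* y.2).

Lemma sim_refl : reflexive sim.
Proof. by move=> x; rewrite /sim !eqxx. Qed.

Lemma sim_sym : symmetric sim.
Proof. by move=> x y; rewrite /sim eq_sym [X in _ && X]eq_sym. Qed.

Lemma sim_trans : transitive sim.
Proof.
move=> y x z /andP[/eqP exy /eqP cxy] /andP[/eqP eyz /eqP cyz].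
by apply/andP; split; [rewrite exy eyz | rewrite cxy cyz].
Qed.

Canonical sim_equiv := EquivRel sim sim_refl sim_sym sim_trans.

Definition face := {eq_quot sim_equiv}%qT.

(* Both functions are independent of the representatives: [face_leE] and
   [face_edgesE]. *)
Definition face_le : rel face := fun x y => pre_le (repr x) (repr y).
Definition face_edges (x : face) : {set edge G} := (repr x).1.

Lemma repr_pi_sim (x : preface) :
  (repr (\pi_face x)%qT).1 = x.1 /\
  T (repr (\pi_face x)%qT).1 :* (repr (\pi_face x)%qT).2 = T x.1 :* x.2.
Proof.
have /eqmodP/= := reprK (\pi_face x)%qT.
by case/andP=> /eqP ? /eqP.
Qed.

Lemma face_leE (x y : preface) :
  face_le (\pi_face x)%qT (\pi_face y)%qT = pre_le x y.
Proof.
have [ex cx] := repr_pi_sim x; have [ey cy] := repr_pi_sim y.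
by rewrite /face_le /pre_le cx cy ex ey.
Qed.

Lemma face_edgesE (x : preface) : face_edges (\pi_face x)%qT = x.1.
Proof. by case: (repr_pi_sim x). Qed.

(* [None] is the adjoined least element. *)
Definition graphicahedron := option face.
HB.instance Definition _ := Choice.on graphicahedron.

Definition graphicahedron_le : rel graphicahedron := fun x y =>
  match x, y with
  | None, _ => true
  | Some _, None => false
  | Some f, Some g => face_le f g
  end.

Lemma graphicahedron_le_refl : reflexive graphicahedron_le.
Proof. by case=> [f|] //=; rewrite /face_le /pre_le !subxx. Qed.

Lemma graphicahedron_le_anti : antisymmetric graphicahedron_le.
Proof.
case=> [f|] [g|] //= /andP[/andP[s1 s2] /andP[s3 s4]]; congr Some.
rewrite -[f]reprK -[g]reprK; apply/eqmodP => /=.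
by rewrite /sim !eqEsubset s1 s2 s3 s4.
Qed.

Lemma graphicahedron_le_trans : transitive graphicahedron_le.
Proof.
case=> [g|] [f|] [h|] //= /andP[s1 s2] /andP[s3 s4].
by rewrite /face_le /pre_le (subset_trans s1 s3) (subset_trans s2 s4).
Qed.

Fact graphicahedron_display : Order.disp_t. Proof. exact. Qed.

HB.instance Definition _ := Order.Le_isPOrder.Build graphicahedron_display
  graphicahedron graphicahedron_le_refl graphicahedron_le_anti
  graphicahedron_le_trans.

Lemma graphicahedron_le0 (x : graphicahedron) : ((None : graphicahedron) <= x)%O.
Proof. by []. Qed.

HB.instance Definition _ := Order.hasBottom.Build graphicahedron_display
  graphicahedron graphicahedron_le0.

Definition rank (x : graphicahedron) : int :=
  if x is Some f then #|face_edges f| else (-1)%Z.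

Definition skeleton_vertex := {x : graphicahedron | rank x == 0%Z}.

Definition skeleton_adj (x y : skeleton_vertex) : Prop :=
  x <> y /\
  exists z : graphicahedron,
    [/\ rank z = 1%Z, (val x <= z)%O & (val y <= z)%O].

End Graphicahedron.

(* Isomorphism of graphs given by their adjacency relations. *)
Definition graph_iso (V W : Type) (adjV : V -> V -> Prop)
    (adjW : W -> W -> Prop) : Prop :=
  exists f : V -> W,
    bijective f /\ forall x y : V, adjV x y <-> adjW (f x) (f y).

(* Main.v *)
(* Since [T set0] is trivial, the rank-0 faces are the classes of the pairs
   [(set0, g)], one for each permutation [g]. Such a face lies below [(K, h)]
   iff [g] belongs to the coset [T K :* h]; for [K = [set e]] this coset is
   [{h, tau e * h}], so a rank-1 face is exactly an edge of the Cayley graph. *)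
Require Import Defs.
From mathcomp Require Import all_boot all_order all_algebra all_fingroup.
From mathcomp Require Import cyclic generic_quotient.

Set Implicit Arguments.
Unset Strict Implicit.
Unset Printing Implicit Defensive.

Import GroupScope.

Section Skeleton.
Variables (p : nat) (G : sgraph p).
Implicit Types (e : edge G) (g : 'S_p) (K : {set edge G}).

(** An edge has two distinct endpoints, so its transposition moves a point and is a nontrivial
    involution. *)
Lemma tau_order2 e : #[tau (val e)] = 2.
Proof.
have /eqP/cards2P[i [j [ij ->]]] := edges_card2 (valP e).
rewrite tauE; apply: nt_prime_order => //; first by rewrite expgS expg1 tperm2.
by apply: contraNneq ij => tij1; rewrite -(tpermL i j) tij1 perm1.
Qed.

Lemma T_set1 e : T [set e] = [set 1; tau (val e)] :> {set 'S_p}.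
Proof. by rewrite /= imset_set1 -(cycle2g (tau_order2 e)). Qed.

Definition vface g : graphicahedron G := Some (\pi_(face G) (set0, g))%qT.

Lemma rank_vface g : rank (vface g) == 0%Z.
Proof. by rewrite /= face_edgesE cards0. Qed.

Definition vertex g : skeleton_vertex G := exist _ (vface g) (rank_vface g).

Lemma vertex_inj : injective vertex.
Proof.
move=> g h /(congr1 val)[] /eqmodP/andP[_ /=].
by rewrite imset0 gen0 !mul1g => /eqP/set1_inj.
Qed.

(** Rank 0 forces the representative to have an empty edge set, so its permutation determines the
    face. The boolean [==] lets [xchoose] extract an inverse map. *)
Lemma vertex_surj (x : skeleton_vertex G) : exists g, vertex g == x.
Proof.
case: x => -[f|//] rk_f; exists (repr f).2; apply/eqP/val_inj; congr Some.
have K0 : (repr f).1 = set0 by apply/eqP; rewrite -cards_eq0.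
by rewrite /= -K0 -surjective_pairing reprK.
Qed.

Lemma vertex_bij : bijective vertex.
Proof.
exists (fun x => xchoose (vertex_surj x)) => [g | x].
  by apply/vertex_inj/eqP/(xchooseP (vertex_surj (vertex g))).
exact/eqP/(xchooseP (vertex_surj x)).
Qed.

Lemma vface_le g K h :
  (vface g <= (Some (\pi_(face G) (K, h))%qT : graphicahedron G))%O
  = (g \in T K :* h).
Proof.
apply: etrans (face_leE _ _) _.
by rewrite /pre_le sub0set /= imset0 gen0 mul1g sub1set.
Qed.

Lemma vertex_adj g h : skeleton_adj (vertex g) (vertex h) <-> cayley_adj G g h.
Proof.
split=> [[gNh [[f|] [rk_f]]] | [e ->]]; last 2 first.
- by [].
(* No loops: [tau (val e) * g = g] would cancel to [tau (val e) = 1], against order 2. *)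
- split=> [/vertex_inj g_eq|].
    have := tau_order2 e; suff ->: tau (val e) = 1 by rewrite order1.
    by apply: (mulIg g); rewrite mul1g -g_eq.
  (* The common rank-1 face is the coset consisting of [g] and [tau (val e) * g]. *)
  exists (Some (\pi_(face G) ([set e], g))%qT).
  rewrite !vface_le !mem_rcoset mulgV mulgK T_set1 !inE !eqxx orbT.
  by split=> //=; rewrite face_edgesE cards1.
have /eqP/cards1P[e Ke] : #|(repr f).1| = 1%N by case: rk_f.
rewrite -[f]reprK [repr f]surjective_pairing Ke !vface_le !mem_rcoset T_set1 !inE.
have tau2 : tau (val e) * tau (val e) = 1.
  by have := expg_order (tau (val e)); rewrite tau_order2 expgS expg1.
set r := (repr f).2.
(* Each of [g], [h] is [r] or [tau (val e) * r]. Equal choices contradict [gNh]; when [h] is [r],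
   the involution [tau2] leads back from [g] to [h]. *)
case/pred2P=> /(canRL (mulgKV r)) g_eq /pred2P[] /(canRL (mulgKV r)) h_eq;
  rewrite g_eq h_eq ?mul1g in gNh *; exists e => //.
by rewrite mulgA tau2 mul1g.
Qed.

End Skeleton.

Theorem theorem2 (p q : nat) (G : sgraph p) (hconn : connected G)
  (hq : #|edges G| = q) :
  graph_iso (@skeleton_adj p G) (@cayley_adj p G).
Proof.
have [f vK fK] := vertex_bij G; exists f; split; first by exists (vertex G).
by move=> x y; rewrite -{1}[x]fK -{1}[y]fK; apply: vertex_adj.
Qed.
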